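(* Let $\theta_1,\ldots,\theta_K$ be $K$ pairwise different elements of $\mathbb{R}^d$. For each $k\in\{1,\ldots,K\}$, suppose that $Y_{k,1},\ldots,Y_{k,N_k}$ are $N_k$ independent random vectors, each with distribution $\mathcal{N}(\theta_k, I_d)$ (the vectors of different clusters being independent as well), and set $N=\sum_{k=1}^K N_k$. Let $$h_N(x)=\frac{\sum_{k=1}^K\sum_{n=1}^{N_k} w(\|Y_{k,n}-x\|^2)\,Y_{k,n}}{\sum_{k=1}^K\sum_{n=1}^{N_k} w(\|Y_{k,n}-x\|^2)},\qquad x\in\mathbb{R}^d,$$ where $w(u)=Q_{d/2}(0,\sqrt{u/2})$ for $u\ge 0$. If there exist $\alpha_1,\ldots,\alpha_K\in(0,1)$ such that $\lim_{N\to\infty}N_k/N=\alpha_k$ for every $k$, then, for any $i\in\{1,\ldots,K\}$ and any $\theta$ in a neighborhood of $\theta_i$, $$\lim_{\forall k\neq i,\ \|\theta_k-\theta_i\|\to\infty}\left(\lim_{N\to\infty}\big(h_N(\theta)-\theta\big)\right)=0\quad\text{if and only if}\quad \theta=\theta_i .$$ Here the inner limit is an almost sure limit.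
   Context: $d\ge 1$ is an integer, $I_d$ is the $d\times d$ identity matrix and $\|\cdot\|$ is the Euclidean norm on $\mathbb{R}^d$. For $\tau,t\in[0,\infty)$, $Q_{d/2}(\tau,t)$ denotes the generalized Marcum function, $Q_{d/2}(\tau,t)=1-F_{\chi^2_d(\tau^2)}(t^2)$, where $F_{\chi^2_d(\tau^2)}$ is the cumulative distribution function of the chi-squared distribution with $d$ degrees of freedom and non-centrality parameter $\tau^2$; equivalently, $Q_{d/2}(\tau,t)=\mathbb{P}[\|Z\|>t]$ for $Z\sim\mathcal{N}(\xi,I_d)$ with $\|\xi\|=\tau$. Meaning of the iterated limit: $i$, $\theta_i$, $\theta$ and $\alpha_1,\ldots,\alpha_K$ are fixed. For given centroids, the inner limit as $N\to\infty$ is an almost sure limit, equal to a deterministic vector depending on $\theta$ and on the centroids. The outer limit is that of this deterministic vector as the other centroids $\theta_k$, $k\neq i$, vary so that all the distances $\|\theta_k-\theta_i\|$, $k\ne i$, tend to infinity jointly. *)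

(* Defs.v *)
From HB Require Import structures.
From mathcomp Require Import all_boot all_order all_algebra finmap.
From mathcomp Require Import all_classical all_reals all_analysis.
From mathcomp Require Import measurable_realfun.
Set Implicit Arguments.
Unset Strict Implicit.
Unset Printing Implicit Defensive.
Import Order.TTheory GRing.Theory Num.Theory.
Import numFieldNormedType.Exports.
Local Open Scope classical_set_scope.
Local Open Scope ring_scope.

(* ['rV[T]_d] carries the product sigma-algebra; for [T := R] this is the Borel
   sigma-algebra of R^d. *)
Definition measure_row_display : measure_display -> measure_display.
Proof. exact. Qed.

Section measurable_row.
Context {disp} {T : sigmaRingType disp}.
Variable d : nat.

Let coors : 'I_d -> 'rV[T]_d -> T := fun j x => x ord0 j.

Let row_set0 : g_sigma_preimage coors set0.
Proof. exact: sigma_algebra0. Qed.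

Let row_setC A : g_sigma_preimage coors A -> g_sigma_preimage coors (~` A).
Proof. exact: sigma_algebraC. Qed.

Let row_bigcup (F : _^nat) : (forall i, g_sigma_preimage coors (F i)) ->
  g_sigma_preimage coors (\bigcup_i (F i)).
Proof. exact: sigma_algebra_bigcup. Qed.

HB.instance Definition _ := @isMeasurable.Build (measure_row_display disp)
  'rV[T]_d (g_sigma_preimage coors) row_set0 row_setC row_bigcup.

End measurable_row.

Lemma measurable_coord disp (T : sigmaRingType disp) d (j : 'I_d) :
  measurable_fun [set: 'rV[T]_d] (fun x : 'rV[T]_d => x ord0 j).
Proof.
move=> _ A mA; rewrite setTI; apply: sub_sigma_algebra => /=.
rewrite -bigcup_seq/=; exists j => /=; first by rewrite mem_index_enum.
by exists A => //; rewrite setTI.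
Qed.

Lemma measurable_fun_row disp1 disp2 (T1 : measurableType disp1)
    (T2 : measurableType disp2) d (f : T1 -> 'rV[T2]_d) :
  (forall j, measurable_fun [set: T1] (fun x => f x ord0 j)) ->
  measurable_fun [set: T1] f.
Proof.
move=> mf; apply: (@measurability _ _ _ _ _ _
    (\big[setU/set0]_(j < d) preimage_set_system setT
       (fun x : 'rV[T2]_d => x ord0 j) measurable)) => //.
move=> _ [B + <-]; rewrite -bigcup_seq => -[j _ [A mA <-]].
by rewrite setTI; exact: mf.
Qed.

Section normal_row.
Variable R : realType.

(* [normal_prob] lives on the copy [measurableTypeR R] of [R]. *)
Definition row_cons d (p : measurableTypeR R * 'rV[R]_d) : 'rV[R]_(1 + d) :=
  row_mx (p.1 : R)%:M p.2.

Let measurable_row_cons d : measurable_fun [set: _] (@row_cons d).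
Proof.
apply: measurable_fun_row => j; rewrite /row_cons.
case: (@split_ordP 1 d j) => k ->.
- under eq_fun do rewrite row_mxEl mxE !ord1 eqxx mulr1n.
  exact: measurable_fst.
- under eq_fun do rewrite row_mxEr.
  exact: measurableT_comp (measurable_coord k) measurable_snd.
Qed.

HB.instance Definition _ d :=
  isMeasurableFun.Build _ _ _ _ (@row_cons d) (@measurable_row_cons d).

(* The law N(mu, I_d) on R^d, i.e. the product of the one-dimensional laws
   N(mu_j, 1). *)
Fixpoint normal_row (d : nat) : 'rV[R]_d -> probability 'rV[R]_d R :=
  match d with
  | 0 => fun=> \d_(0 : 'rV[R]_0)
  | d'.+1 => fun mu : 'rV[R]_(1 + d') =>
      distribution (normal_prob (mu ord0 ord0) 1 \x normal_row (rsubmx mu))%E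
        (@row_cons d')
  end.

End normal_row.

Section marcum.
Variable R : realType.

(* The Euclidean norm; the library's [`|x|] on ['rV[R]_d] is the sup norm. *)
Definition enorm d (x : 'rV[R]_d) : R :=
  Num.sqrt (\sum_(j < d) x ord0 j ^+ 2).

Definition enorm2 d (x : 'rV[R]_d) : R := enorm x ^+ 2.

Let measurable_enorm2 d : measurable_fun [set: 'rV[R]_d] (@enorm2 d).
Proof.
have -> : @enorm2 d = fun x => \sum_(j < d) x ord0 j ^+ 2.
  apply/funext => x; rewrite /enorm2 sqr_sqrtr// sumr_ge0// => j _.
  exact: sqr_ge0.
apply: measurable_sum => j; apply: measurable_funX.
exact: measurable_coord.
Qed.

HB.instance Definition _ d :=
  isMeasurableFun.Build _ _ _ _ (@enorm2 d) (@measurable_enorm2 d).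

(* The noncentral chi-squared law is that of |Z|^2 with Z ~ N(xi, I_d) and
   |xi|^2 = lam; by rotation invariance it depends on xi only through |xi|,
   and xi = (sqrt lam, 0, ..., 0) is used here. *)
Definition noncentral_chi2 (d : nat) (lam : R) : probability R R :=
  distribution
    (normal_row (\row_(j < d) if j == 0%N :> nat then Num.sqrt lam else 0))
    (@enorm2 d).

Definition noncentral_chi2_cdf (d : nat) (lam x : R) : R :=
  fine (noncentral_chi2 d lam `]-oo, x]%classic).

(* [marcumQ d] is the generalized Marcum function Q_{d/2}. *)
Definition marcumQ (d : nat) (tau t : R) : R :=
  1 - noncentral_chi2_cdf d (tau ^+ 2) (t ^+ 2).

End marcum.

Section clustering.
Variable R : realType.

Definition weight (d : nat) (u : R) : R := marcumQ d 0 (Num.sqrt (u / 2)).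

(* h_N for the sample y k 0, ..., y k (Nk k - 1), k < K. *)
Definition weighted_mean d K (y : 'I_K -> nat -> 'rV[R]_d) (Nk : 'I_K -> nat)
    (x : 'rV[R]_d) : 'rV[R]_d :=
  (\sum_(k < K) \sum_(n < Nk k) weight d (enorm (y k n - x) ^+ 2))^-1 *:
  \sum_(k < K) \sum_(n < Nk k) weight d (enorm (y k n - x) ^+ 2) *: y k n.

Definition mutually_independent disp dispT (Om : measurableType disp)
    (T : measurableType dispT) (P : probability Om R) (I : choiceType)
    (X : I -> {RV P >-> T}) : Prop :=
  forall (J : {fset I}) (A : I -> set T),
    (forall i, i \in J -> measurable (A i)) ->
    P (\bigcap_(i in [set` J]) X i @^-1` A i) =
    (\prod_(i <- J) P (X i @^-1` A i))%E.

(* Pairwise distinct centroids c with c i = thetai fixed and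
   min_{k != i} |c k - thetai| -> oo. *)
Definition others_to_infty d K (i : 'I_K) (thetai : 'rV[R]_d) :
    set_system ('I_K -> 'rV[R]_d) :=
  filter_from [set: R] (fun M => [set c | [/\ injective c, c i = thetai &
    forall k, k != i -> M <= enorm (c k - thetai)]]).

End clustering.

(* Main.v *)
From HB Require Import structures.
Require Import Defs.
From mathcomp Require Import all_boot all_order all_algebra finmap.
From mathcomp Require Import all_classical all_reals all_analysis.
From mathcomp Require Import measurable_realfun lra zify.
Set Implicit Arguments.
Unset Strict Implicit.
Unset Printing Implicit Defensive.
Import Order.TTheory GRing.Theory Num.Theory.
Import numFieldNormedType.Exports.
Local Open Scope classical_set_scope.
Local Open Scope ring_scope.

(* By the strong law of large numbers for bounded variables, the inner limit is
   (sum_k alpha_k G_k) / (sum_k alpha_k H_k), where G_k and H_k are the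
   expectations of w(|Y - theta|^2) (Y - theta) and w(|Y - theta|^2) under
   N(theta_k, I_d).  Chebyshev's inequality gives w(u) = O(1 / (1 + u)), so that
   G_k and H_k vanish as theta_k goes to infinity and the outer limit is
   G_i / H_i.  The weight is positive and invariant under the reflection of each
   coordinate of y - theta, hence the j-th coordinate of G_i has the sign of the
   j-th coordinate of theta_i - theta. *)

(** * Integrals of bounded measurable functions against a probability *)

Section bounded_measurable.
Context {disp} {T : measurableType disp} {R : realType}.
Implicit Types (f g : T -> R) (P : probability T R).

(** Gaussian expectations are only ever taken of bounded measurable functions, for which
    integrability and Fubini come for free. The obstacle is the numerator, where the weight
    multiplies the unbounded vector z = y - theta. Since w(|z|^2) |z|^2 is bounded, so is w(|z|^2)
    z, and one law of large numbers serves numerator and denominator alike. Second moments of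
    Gaussian vectors are likewise replaced by quadratic upper bounds on bounded functions.

    Centring at theta turns h_N(theta) - theta into a ratio whose numerator has summands odd under
    each coordinate reflection at theta. The oddness is exploited through [Num.sg] rather than
    through inequalities: a sign that is constant in the remaining coordinates survives integration
    over them, value 0 included, so a single identity of signs yields both directions of the
    equivalence. *)

Definition bmeas f :=
  measurable_fun [set: T] f /\ exists C, forall x, `|f x| <= C.

Lemma bmeas_cst (r : R) : bmeas (fun=> r).
Proof. by split; [exact: measurable_cst|exists `|r|]. Qed.

Lemma bmeasD f g : bmeas f -> bmeas g -> bmeas (fun x => f x + g x).
Proof.
move=> [mf [C fC]] [mg [D gD]]; split; first exact: measurable_funD.
by exists (C + D) => x; rewrite (le_trans (ler_normD _ _))// lerD.
Qed.

Lemma bmeasM f g : bmeas f -> bmeas g -> bmeas (fun x => f x * g x).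
Proof.
move=> [mf [C fC]] [mg [D gD]]; split; first exact: measurable_funM.
by exists (C * D) => x; rewrite normrM ler_pM.
Qed.

Lemma bmeasN f : bmeas f -> bmeas (fun x => - f x).
Proof.
move=> [mf [C fC]]; split; first exact: measurableT_comp.
by exists C => x; rewrite normrN.
Qed.

Lemma bmeasB f g : bmeas f -> bmeas g -> bmeas (fun x => f x - g x).
Proof. by move=> bf bg; apply: bmeasD => //; exact: bmeasN. Qed.

Lemma bmeas_sum (f : nat -> T -> R) N :
  (forall n, bmeas (f n)) -> bmeas (fun x => \sum_(n < N) f n x).
Proof.
move=> bf; elim: N => [|N IH].
  by under eq_fun do rewrite big_ord0; exact: bmeas_cst.
by under eq_fun do rewrite big_ord_recr/=; exact: bmeasD.
Qed.

Lemma bmeas_integrable P f : bmeas f -> P.-integrable [set: T] (EFin \o f).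
Proof.
move=> [mf [C fC]]; apply: measurable_bounded_integrable => //.
  by rewrite (le_lt_trans (probability_le1 _ _))// ltry.
exists C; split; first exact: num_real.
by move=> D CD x _; apply: le_trans (fC x) _; exact: ltW.
Qed.

Lemma bmeas_RintegralE P f : bmeas f ->
  (\int[P]_x f x)%:E = (\int[P]_x (f x)%:E)%E.
Proof.
by move=> bf; rewrite fineK//; apply: integrable_fin_num => //;
  exact: bmeas_integrable.
Qed.

Lemma bmeas_RintegralD P f g : bmeas f -> bmeas g ->
  \int[P]_x (f x + g x) = \int[P]_x f x + \int[P]_x g x.
Proof. by move=> bf bg; rewrite RintegralD//; exact: bmeas_integrable. Qed.

Lemma bmeas_RintegralB P f g : bmeas f -> bmeas g ->
  \int[P]_x (f x - g x) = \int[P]_x f x - \int[P]_x g x.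
Proof. by move=> bf bg; rewrite RintegralB//; exact: bmeas_integrable. Qed.

Lemma bmeas_RintegralZl P f r : bmeas f ->
  \int[P]_x (r * f x) = r * \int[P]_x f x.
Proof. by move=> bf; rewrite RintegralZl//; exact: bmeas_integrable. Qed.

Lemma Rintegral_prob_cst P r : \int[P]_x r = r.
Proof. by rewrite Rintegral_cst//= probability_setT mulr1. Qed.

Lemma bmeas_le_Rintegral P f g : bmeas f -> bmeas g ->
  (forall x, f x <= g x) -> \int[P]_x f x <= \int[P]_x g x.
Proof.
by move=> bf bg fg; apply: le_Rintegral => //; exact: bmeas_integrable.
Qed.

Lemma normr_Rintegral_le P f C : bmeas f -> (forall x, `|f x| <= C) ->
  `|\int[P]_x f x| <= C.
Proof.
move=> bf fC; have bC := bmeas_cst C; rewrite ler_norml.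
have bNC := bmeas_cst (- C); rewrite -(Rintegral_prob_cst P (- C)).
rewrite -[X in _ && (_ <= X)](Rintegral_prob_cst P C).
by apply/andP; split; apply: bmeas_le_Rintegral => // x;
  have := fC x; rewrite ler_norml => /andP[].
Qed.

(** Jensen's inequality for the square, from expanding the nonnegative integral of [(f x - m) ^+ 2]
    at the mean [m]. *)
Lemma sqr_Rintegral_le P f : bmeas f ->
  (\int[P]_x f x) ^+ 2 <= \int[P]_x (f x ^+ 2).
Proof.
move=> bf; set m := \int[P]_x f x.
have : 0 <= \int[P]_x ((f x * f x - (2 * m) * f x) + m * m).
  apply: Rintegral_ge0 => x _; have := sqr_ge0 (f x - m).
  by rewrite (_ : (_ - _) ^+ 2 = f x * f x - 2 * m * f x + m * m)//; lra.
have bff := bmeasM bf bf; have bmf := bmeasM (bmeas_cst (2 * m)) bf.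
rewrite bmeas_RintegralD//; [|exact: bmeasB|exact: bmeas_cst].
rewrite bmeas_RintegralB// bmeas_RintegralZl// Rintegral_prob_cst -/m.
rewrite [X in X - _](@eq_Rintegral _ _ _ _ _ (fun x => f x ^+ 2))//.
set v := \int[P]_x _; nra.
Qed.

(** A nonnegative function of zero integral vanishes almost everywhere, which would make [A]
    negligible. *)
Lemma Rintegral_gt0 (mu : {measure set T -> \bar R}) f (A : set T) :
  mu.-integrable [set: T] (EFin \o f) -> measurable A -> mu A != 0%E ->
  (forall x, 0 <= f x) -> (forall x, A x -> 0 < f x) ->
  0 < \int[mu]_x f x.
Proof.
move=> intf mA muA f0 fA0; rewrite lt_neqAle Rintegral_ge0 ?andbT//.
apply: contra_neq muA => int0.
have mf := measurable_int _ intf.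
have : (\int[mu]_x `|(f x)%:E| = 0)%E.
  under eq_integral do rewrite gee0_abs ?lee_fin//.
  rewrite -[LHS]fineK; last exact: integrable_fin_num.
  by rewrite -[fine _]/(\int[mu]_x f x) -int0.
move=> /(@ae_eq_integral_abs _ _ _ mu _ measurableT _ mf) aef.
apply: measure_negligible => //; apply: negligibleS aef => x Ax /= /(_ I) [fx0].
by have := fA0 _ Ax; rewrite fx0 ltxx.
Qed.

Lemma sgr_Rintegral P f s : bmeas f -> (forall x, Num.sg (f x) = Num.sg s) ->
  Num.sg (\int[P]_x f x) = Num.sg s.
Proof.
move=> bf fs.
have gt0 g : bmeas g -> (forall x, 0 < g x) -> 0 < \int[P]_x g x.
  move=> bg g0; apply: (@Rintegral_gt0 P g [set: T]) => //.
  - exact: bmeas_integrable.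
  - by rewrite /= probability_setT.
  - by move=> x; exact: ltW.
have [s0|s0|s0] := ltgtP s 0.
- have : 0 < \int[P]_x (-1 * f x).
    apply: gt0; first by apply: bmeasM => //; exact: bmeas_cst.
    move=> x; rewrite mulN1r oppr_gt0 -sgr_lt0 fs sgr_lt0//.
  by rewrite bmeas_RintegralZl// mulN1r oppr_gt0 => h; rewrite !ltr0_sg.
- have : 0 < \int[P]_x f x.
    by apply: gt0 => // x; rewrite -sgr_gt0 fs sgr_gt0.
  by move=> h; rewrite !gtr0_sg.
- rewrite (@eq_Rintegral _ _ _ _ _ (fun=> 0)) ?Rintegral_prob_cst ?s0//.
  by move=> x _; apply/eqP; rewrite -sgr_eq0 fs s0 sgr0.
Qed.

Lemma bmeas_indic (A : set T) : measurable A -> bmeas (\1_A).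
Proof.
split; first exact: measurable_indic.
by exists 1 => x; rewrite indicE; case: (_ \in _); rewrite ?normr0 ?normr1.
Qed.

Lemma Rintegral_indic_prob P (A : set T) : measurable A ->
  \int[P]_x (\1_A x : R) = fine (P A).
Proof. by move=> mA; rewrite /Rintegral integral_indic// setIT. Qed.

End bounded_measurable.

Lemma bmeas_comp disp disp' (T : measurableType disp) (T' : measurableType disp')
    (R : realType) (h : T' -> T) (f : T -> R) :
  measurable_fun [set: T'] h -> bmeas f -> bmeas (f \o h).
Proof.
move=> mh [mf [C fC]]; split; first exact: measurableT_comp.
by exists C => x /=.
Qed.

(** * Strong law of large numbers for bounded uncorrelated variables *)

Section slln.
Context {disp} {T : measurableType disp} {R : realType} (P : probability T R).

Section centered.
Variables (Z : nat -> T -> R) (C : R).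
Hypothesis mZ : forall n, measurable_fun [set: T] (Z n).
Hypothesis ZC : forall n x, `|Z n x| <= C.
Hypothesis Zorth : forall n p, n != p -> \int[P]_x (Z n x * Z p x) = 0.

Let S N x := \sum_(n < N) Z n x.

Let bZ n : bmeas (Z n). Proof. by split => //; exists C. Qed.

Let bS N : bmeas (S N). Proof. exact: bmeas_sum. Qed.

Let C0 : 0 <= C.
Proof. by apply: le_trans (ZC 0 point). Qed.

Let S_orth N p : (N <= p)%N -> \int[P]_x (S N x * Z p x) = 0.
Proof.
elim: N => [|N IH] Np.
  under eq_Rintegral do rewrite /S big_ord0 mul0r.
  by rewrite Rintegral_prob_cst.
under eq_Rintegral do rewrite /S big_ord_recr/= mulrDl -/(S N _).
rewrite (bmeas_RintegralD _ (bmeasM (bS N) (bZ p)) (bmeasM (bZ N) (bZ p))).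
by rewrite IH 1?ltnW// Zorth ?addr0// ltn_eqF.
Qed.

(** Orthogonality removes the cross terms, so the second moment grows only linearly in [N]. *)
Let S_sqr N : \int[P]_x (S N x ^+ 2) <= N%:R * C ^+ 2.
Proof.
elim: N => [|N IH].
  under eq_Rintegral do rewrite /S big_ord0 expr0n/=.
  by rewrite Rintegral_prob_cst mul0r.
rewrite (@eq_Rintegral _ _ _ _ _
  (fun x => S N x * S N x + 2 * (S N x * Z N x) + Z N x * Z N x)); last first.
  by move=> x _; rewrite /S big_ord_recr/=; lra.
have b1 := bmeasM (bS N) (bS N); have b2 := bmeasM (bS N) (bZ N).
have b3 := bmeasM (bZ N) (bZ N); have b4 := bmeasM (bmeas_cst 2) b2.
rewrite bmeas_RintegralD//; last exact: bmeasD.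
rewrite bmeas_RintegralD// bmeas_RintegralZl// S_orth// mulr0 addr0.
rewrite -natr1 mulrDl mul1r lerD//.
rewrite -[leRHS](Rintegral_prob_cst P); apply: bmeas_le_Rintegral => //.
  exact: bmeas_cst.
move=> x; rewrite -expr2 -real_normK ?num_real//.
by rewrite lerXn2r// nnegrE.
Qed.

(* Along the squares the second moments of the averages are summable; the gap
   between consecutive squares is controlled by boundedness. *)
Let V n x := (S (n.+1 ^ 2) x / (n.+1 ^ 2)%:R) ^+ 2.

Let bV n : bmeas (V n).
Proof.
have -> : V n = fun x => (S (n.+1 ^ 2) x * ((n.+1 ^ 2)%:R)^-1) *
    (S (n.+1 ^ 2) x * ((n.+1 ^ 2)%:R)^-1) by [].
by apply: bmeasM; apply: bmeasM => //; exact: bmeas_cst.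
Qed.

Let V_int n : \int[P]_x V n x <= C ^+ 2 / (n.+1)%:R ^+ 2.
Proof.
rewrite (@eq_Rintegral _ _ _ _ _
  (fun x => ((n.+1)%:R ^- 4) * (S (n.+1 ^ 2) x * S (n.+1 ^ 2) x))); last first.
  by move=> x _; rewrite /V natrX exprMn exprVn -exprM mulrC expr2.
rewrite bmeas_RintegralZl; last exact: bmeasM.
have := S_sqr (n.+1 ^ 2); rewrite natrX.
under eq_Rintegral do rewrite expr2.
set a := \int[P]_x _ => h.
have -> : C ^+ 2 / n.+1%:R ^+ 2 = n.+1%:R ^- 4 * (n.+1%:R ^+ 2 * C ^+ 2).
  have : n.+1%:R ^+ 2 != 0 :> R by rewrite expf_neq0.
  rewrite -[4%N]/(2 * 2)%N exprM; move: (n.+1%:R ^+ 2) (C ^+ 2) => b c b0.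
  by rewrite [b ^+ 2]expr2 invfM -mulrA mulKf// mulrC.
by rewrite ler_pM2l// invr_gt0 exprn_gt0.
Qed.

Let V_sum n : \sum_(k < n) \int[P]_x V k x <= 2 * C ^+ 2.
Proof.
(* The bound is strengthened for the induction: 1/(a+1)^2 <= 1/a - 1/(a+1) makes the sum
   telescope. *)
suff : \sum_(k < n.+1) \int[P]_x V k x <= C ^+ 2 * (2 - n.+1%:R^-1).
  move=> h; apply: (@le_trans _ _ (\sum_(k < n.+1) \int[P]_x V k x)).
    by rewrite big_ord_recr/= lerDl Rintegral_ge0// => x _; exact: sqr_ge0.
  rewrite (le_trans h)// mulrC ler_wpM2r ?sqr_ge0// gerBl//.
elim: n => [|n IH].
  rewrite big_ord_recr big_ord0/= add0r (le_trans (V_int _))//.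
  by rewrite invr1 expr1n divr1; lra.
rewrite big_ord_recr/= (le_trans (lerD IH (V_int _)))//.
rewrite -mulrDr ler_wpM2l ?sqr_ge0//.
have n0 : 0 < n.+1%:R :> R by [].
rewrite -(natr1 n.+1); set a := n.+1%:R in n0 *.
have : (a + 1) ^- 2 <= a^-1 - (a + 1)^-1.
  have -> : a^-1 - (a + 1)^-1 = (a * (a + 1))^-1.
    rewrite -[a^-1]div1r -[(a + 1)^-1]div1r -mulNr addf_div ?gt_eqF//; last lra.
    by rewrite -[RHS]div1r; congr (_ / _); lra.
  by rewrite lef_pV2 ?posrE ?mulr_gt0 ?exprn_gt0//; nra.
by move: ((a + 1) ^- 2) a^-1 (a + 1)^-1 => p q r; lra.
Qed.

(** The series of the [V n] has a finite integral, hence is finite almost everywhere, and its terms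
    tend to 0 there. *)
Let V_cvg : {ae P, forall x, V n x @[n --> \oo] --> (0 : R)}.
Proof.
have mV n : measurable_fun [set: T] (EFin \o V n).
  by apply/measurable_EFinP; case: (bV n).
have V0 n x : (0 <= (EFin \o V n) x)%E by rewrite lee_fin sqr_ge0.
have fin : (\int[P]_x (\sum_(n <oo) (EFin \o V n) x) < +oo)%E.
  rewrite integral_nneseries//.
  apply: (@le_lt_trans _ _ (2 * C ^+ 2)%:E); last exact: ltry.
  apply: lime_le; first by apply: is_cvg_nneseries => n _ _; exact: integral_ge0.
  apply: nearW => n; rewrite big_mkord.
  under eq_bigr do rewrite -bmeas_RintegralE//.
  by rewrite sumEFin lee_fin.
have int : P.-integrable [set: T] (fun x => \sum_(n <oo) (EFin \o V n) x)%E.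
  apply/integrableP; split; first exact: ge0_emeasurable_sum.
  by under eq_integral do rewrite gee0_abs ?nneseries_ge0//.
apply: filterS (integrable_ae measurableT int) => x /(_ I) sfin.
apply: cvg_series_cvg_0; apply: nondecreasing_is_cvgn.
  by apply: nondecreasing_series => n _ _; exact: sqr_ge0.
exists (fine (\sum_(n <oo) (EFin \o V n) x)%E) => _ [n _ <-].
rewrite -lee_fin fineK//.
have := @nneseries_lim_ge R (fun n => (V n x)%:E) xpredT 0%N n (fun n _ _ => V0 n x).
by rewrite seriesEnat sumEFin.
Qed.

Lemma centered_slln :
  {ae P, forall x, (\sum_(n < N) Z n x) / N%:R @[N --> \oo] --> (0 : R)}.
Proof.
apply: filterS V_cvg => x Vx.
have S_diff n k : `|S (n + k) x - S n x| <= k%:R * C.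
  elim: k => [|k IH]; first by rewrite addn0 subrr normr0 mul0r.
  rewrite addnS /S big_ord_recr/= -/(S (n + k) x) addrAC -natr1 mulrDl mul1r.
  by rewrite (le_trans (ler_normD _ _))// lerD.
apply/cvgrPdist_le => /= e e0.
have e2 : 0 < e / 2 by rewrite divr_gt0.
have e22 : 0 < (e / 2) ^+ 2 by rewrite exprn_gt0.
have /cvgrPdist_le/(_ _ e22)[n0 _ hn0] := Vx.
(* Past [n0] the average at a square is at most e/2; once n+1 exceeds 6C/e, the gap contribution
   3(n+1)C is at most (e/2)(n+1)^2. *)
pose n1 := maxn n0 (Num.trunc (6 * C / e)).+1.
exists (n1.+1 ^ 2)%N => // M /= hM.
(* The largest n with (n+1)^2 <= M: maximality gives M < (n+2)^2, so M exceeds (n+1)^2 by at most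
   2(n+1). *)
have [n [n1n nM Mn]] : exists n, [/\ (n1 <= n)%N, (n.+1 ^ 2 <= M)%N &
    (M <= n.+1 ^ 2 + 3 * n.+1)%N].
  have ex : exists n, (n.+1 ^ 2 <= M)%N by exists n1.
  have ub n : (n.+1 ^ 2 <= M)%N -> (n <= M)%N.
    by move=> h; apply: leq_trans h; nia.
  have nM := ex_maxnP ex ub.
  case: nM => n nM nmax; exists n; split => //; first exact: nmax.
  have /contraNN : (n.+2 ^ 2 <= M)%N -> (n.+1 <= n)%N by exact: nmax.
  by rewrite ltnn -ltnNge => /(_ isT); nia.
rewrite sub0r normrN -/(S M x).
set q := (n.+1 ^ 2)%N in nM Mn.
have q0 : 0 < q%:R :> R by rewrite ltr0n expn_gt0.
have M0 : 0 < M%:R :> R by rewrite (lt_le_trans q0)// ler_nat.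
have Sq : `|S q x| <= e / 2 * q%:R.
  have n0n : (n0 <= n)%N by rewrite (leq_trans _ n1n)// leq_maxl.
  have := hn0 n n0n; rewrite sub0r normrN ger0_norm ?sqr_ge0//.
  rewrite /V -/q -[leLHS]real_normK ?num_real// ler_sqr ?nnegrE ?(ltW e2)//.
  by rewrite normrM normfV (ger0_norm (ltW q0)) ler_pdivrMr.
have SM : `|S M x - S q x| <= e / 2 * q%:R.
  have := S_diff q (M - q)%N; rewrite (subnKC nM) => /le_trans; apply.
  have hC : 6 * C / e < n.+1%:R.
    have h0 : 0 <= 6 * C / e by rewrite divr_ge0 ?mulr_ge0// ltW.
    apply: lt_le_trans (truncnS_gt _) _.
    by rewrite ler_nat ltnW// ltnS (leq_trans _ n1n)// leq_maxr.
  rewrite ltr_pdivrMr// in hC.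
  have : (M - q)%:R <= 3 * n.+1%:R :> R by rewrite -natrM ler_nat leq_subLR.
  rewrite /q natrX; set a := (M - q)%:R; set b := n.+1%:R in hC *.
  have b0 : 0 < b by [].
  move=> ab; have : 0 <= (3 * b - a) * C by rewrite mulr_ge0 ?subr_ge0.
  have : 0 <= b * (b * e - 6 * C) by rewrite mulr_ge0 ?(ltW b0)//; lra.
  lra.
rewrite normrM normfV (ger0_norm (ltW M0)) ler_pdivrMr//.
rewrite -(subrK (S q x) (S M x)) (le_trans (ler_normD _ _))//.
have : q%:R <= M%:R :> R by rewrite ler_nat.
nra.
Qed.

End centered.

Lemma slln (X : nat -> T -> R) (C m : R) :
  (forall n, measurable_fun [set: T] (X n)) ->
  (forall n x, `|X n x| <= C) ->
  (forall n, \int[P]_x X n x = m) ->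
  (forall n p, n != p -> \int[P]_x (X n x * X p x) = m * m) ->
  {ae P, forall x, (\sum_(n < N) X n x) / N%:R @[N --> \oo] --> m}.
Proof.
move=> mX XC Xm Xuncorr.
have bX n : bmeas (X n) by split => //; exists C.
have : {ae P, forall x,
    (\sum_(n < N) (X n x - m)) / N%:R @[N --> \oo] --> (0 : R)}.
  apply: (@centered_slln (fun n x => X n x - m) (C + `|m|)).
  - by move=> n; apply: measurable_funB.
  - by move=> n x; rewrite (le_trans (ler_normB _ _))// lerD.
  - move=> n p np; rewrite (@eq_Rintegral _ _ _ _ _
      (fun x => X n x * X p x - m * X n x - m * X p x + m * m)); last first.
      by move=> x _; lra.
    have b1 := bmeasM (bX n) (bX p); have b2 := bmeasM (bmeas_cst m) (bX n).
    have b3 := bmeasM (bmeas_cst m) (bX p); have b4 := bmeasB b1 b2.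
    rewrite bmeas_RintegralD; [|exact: bmeasB|exact: bmeas_cst].
    rewrite !bmeas_RintegralB// Rintegral_prob_cst !bmeas_RintegralZl//.
    by rewrite Xuncorr// !Xm; lra.
apply: filterS => x hx.
rewrite -[m]add0r.
apply: cvg_trans (cvgD hx (cvg_cst m)).
apply: near_eq_cvg; near=> N => /=.
have N0 : N%:R != 0 :> R by rewrite pnatr_eq0 -lt0n; near: N; exact: nbhs_infty_gt.
by rewrite fctE sumrB sumr_const card_ord mulrBl -[m *+ N]mulr_natr mulfK// subrK.
Unshelve. all: by end_near. Qed.

End slln.

(** * Image laws, product measures and independence *)

Section transfer.
Context {d1 d2} {T1 : measurableType d1} {T2 : measurableType d2}
  {R : realType}.

Lemma bmeas_Rintegral_distribution (P : probability T1 R)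
    (X : {RV P >-> T2}) (f : T2 -> R) : bmeas f ->
  \int[distribution P X]_y f y = \int[P]_x f (X x).
Proof.
move=> bf; congr fine; rewrite integral_distribution//.
  by apply/measurable_EFinP; case: bf.
by apply: (bmeas_integrable P (bmeas_comp _ bf)); exact: measurable_funPT.
Qed.

Lemma eq_measure_Rintegral (m1 m2 : {measure set T1 -> \bar R}) (f : T1 -> R) :
  (forall A, measurable A -> m1 A = m2 A) ->
  \int[m1]_x f x = \int[m2]_x f x.
Proof. by move=> m12; congr fine; apply: eq_measure_integral => A mA _; exact: m12. Qed.

Variables (m1 : probability T1 R) (m2 : probability T2 R).
Variable f : T1 * T2 -> R.
Hypothesis bf : bmeas f.

Lemma bmeas_section1 x : bmeas (fun y => f (x, y)).
Proof. exact: bmeas_comp (measurable_pair1 x) bf. Qed.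

Lemma bmeas_section2 y : bmeas (fun x => f (x, y)).
Proof. exact: bmeas_comp (measurable_pair2 y) bf. Qed.

Let intf : (m1 \x m2)%E.-integrable [set: T1 * T2] (EFin \o f).
Proof. exact: (bmeas_integrable (m1 \x m2)%E). Qed.

(** Partial integration preserves [bmeas], so inductions on the dimension can be run inside this
    class. *)
Lemma bmeas_Rintegral_fst : bmeas (fun x => \int[m2]_y f (x, y)).
Proof.
split; last first.
  have [_ [C fC]] := bf; exists C => x.
  by apply: normr_Rintegral_le => //; exact: bmeas_section1.
apply/measurable_EFinP.
rewrite (_ : _ \o _ = fubini_F m2 (EFin \o f)).
  by apply: measurable_fubini_F; exact: (bmeas_integrable (m1 \x m2)%E bf).
apply/funext => x; rewrite /fubini_F/=; apply: bmeas_RintegralE.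
exact: bmeas_section1.
Qed.

Lemma bmeas_Rintegral_snd : bmeas (fun y => \int[m1]_x f (x, y)).
Proof.
split; last first.
  have [_ [C fC]] := bf; exists C => y.
  by apply: normr_Rintegral_le => //; exact: bmeas_section2.
apply/measurable_EFinP.
rewrite (_ : _ \o _ = fubini_G m1 (EFin \o f)).
  by apply: measurable_fubini_G; exact: (bmeas_integrable (m1 \x m2)%E bf).
apply/funext => y; rewrite /fubini_G/=; apply: bmeas_RintegralE.
exact: bmeas_section2.
Qed.

Lemma bmeas_fubini1 :
  \int[(m1 \x m2)%E]_z f z = \int[m1]_x \int[m2]_y f (x, y).
Proof.
congr fine; rewrite -integral12_prod_meas1//; apply: eq_integral => x _.
rewrite /fubini_F/=; apply/esym/bmeas_RintegralE; exact: bmeas_section1.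
Qed.

Lemma bmeas_fubini2 :
  \int[(m1 \x m2)%E]_z f z = \int[m2]_y \int[m1]_x f (x, y).
Proof.
congr fine; rewrite -integral21_prod_meas1//; apply: eq_integral => x _.
rewrite /fubini_G/=; apply/esym/bmeas_RintegralE; exact: bmeas_section2.
Qed.

End transfer.

Section uncorrelated.
Context {d d'} {T : measurableType d} {T' : measurableType d'} {R : realType}.
Variables (P : probability T R) (X Y : {RV P >-> T'}).
Hypothesis XY : forall A B, measurable A -> measurable B ->
  P (X @^-1` A `&` Y @^-1` B) = (P (X @^-1` A) * P (Y @^-1` B))%E.

Let W : T -> T' * T' := fun x => (X x, Y x).

Let mW : measurable_fun [set: T] W.
Proof. by apply: measurable_fun_pair. Qed.

HB.instance Definition _ := isMeasurableFun.Build _ _ _ _ W mW.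

(** Independence says that the joint law and the product of the marginals agree on rectangles, hence
    everywhere; Fubini then factors the integral. *)
Lemma independent_Rintegral_mul (f g : T' -> R) : bmeas f -> bmeas g ->
  \int[P]_x (f (X x) * g (Y x)) = (\int[P]_x f (X x)) * \int[P]_x g (Y x).
Proof.
move=> bf bg.
have bfg : bmeas (fun z : T' * T' => f z.1 * g z.2).
  by apply: bmeasM; [exact: bmeas_comp measurable_fst bf|
    exact: bmeas_comp measurable_snd bg].
rewrite -(bmeas_Rintegral_distribution W bfg).
rewrite -(@eq_measure_Rintegral _ _ _ (distribution P X \x distribution P Y)%E);
  last first.
  by move=> A mA; apply: product_measure_unique.
rewrite bmeas_fubini1//=.
under eq_Rintegral do rewrite bmeas_RintegralZl//.
under eq_Rintegral do rewrite mulrC.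
by rewrite bmeas_RintegralZl// mulrC !bmeas_Rintegral_distribution.
Qed.

End uncorrelated.

(** * One-dimensional normal laws: reflection, signs and a second moment bound *)

Section normal1.
Context {R : realType}.
Notation leb := (@lebesgue_measure R).
Implicit Types (f g : measurableTypeR R -> R) (m t : R).

(** The density coincides almost everywhere with the Radon-Nikodym derivative, both having the same
    integral over every measurable set. *)
Lemma integral_normal_prob m f : bmeas f ->
  \int[normal_prob m 1]_x f x = \int[leb]_x (f x * normal_pdf m 1 x).
Proof.
move=> bf; congr fine.
have dom := normal_prob_dominates m 1.
have intf := bmeas_integrable (normal_prob m 1) bf.
have mf : measurable_fun [set: measurableTypeR R] f by case: bf.
have mpdf := measurable_normal_pdf m (1 : R).
rewrite -(Radon_Nikodym_change_of_variables dom)//.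
under [RHS]eq_integral do rewrite EFinM.
apply: ae_eq_integral => //.
- apply: emeasurable_funM; first exact/measurable_EFinP.
  apply: (measurable_int leb); exact: Radon_Nikodym_integrable.
- by apply: emeasurable_funM; exact/measurable_EFinP.
- apply: ae_eqe_mul2l; rewrite Radon_NikodymE//=.
  case: cid => /= h [h1 h2 h3].
  apply: integral_ae_eq => //=; first exact/measurable_EFinP.
  by move=> E E01 mE; rewrite -h3.
Qed.

Lemma integrable_bmeas_normal_pdf m s f : bmeas f ->
  leb.-integrable [set: measurableTypeR R]
    (EFin \o (fun x => f x * normal_pdf m s x)).
Proof.
move=> [mf [C fC]].
rewrite (_ : EFin \o _ = (EFin \o f) \* (fun x => (normal_pdf m s x)%:E))%E//.
apply: (integrableMr measurableT mf) => //; last exact: integrable_normal_pdf.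
exists C; split; first exact: num_real.
by move=> D CD x _; apply: le_trans (fC x) _; exact: ltW.
Qed.

Lemma Rintegral_normal_pdf m s : \int[leb]_x normal_pdf m s x = 1.
Proof. by rewrite /Rintegral integral_normal_pdf. Qed.

Definition reflection (t : R) (x : measurableTypeR R) : measurableTypeR R := t - x.

Let measurable_reflection t : measurable_fun [set: _] (reflection t).
Proof. by apply: measurable_funB. Qed.

HB.instance Definition _ t :=
  isMeasurableFun.Build _ _ _ _ (reflection t) (@measurable_reflection t).

(** Reflection moves the closed end of a half-open interval to the other side but keeps its length,
    and these lengths determine Lebesgue measure. *)
Lemma lebesgue_measure_reflect (t : R) (A : set R) : measurable A ->
  pushforward leb (reflection t) A = leb A.
Proof.
move=> mA; apply/esym/lebesgue_measure_unique => //= _ [[a b]] _ <-.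
rewrite /pushforward.
rewrite (_ : reflection t @^-1` _ = `[t - b, t - a[%classic); last first.
  by apply/seteqP; split => x /=; rewrite /reflection !in_itv/= => /andP[h1 h2];
    apply/andP; split; lra.
rewrite !lebesgue_measure_itv/= !lte_fin.
rewrite (_ : (t - b < t - a) = (a < b)); last by lra.
by case: ifP => // _; congr (_%:E); lra.
Qed.

Lemma Rintegral_reflect (t : R) f :
  leb.-integrable [set: measurableTypeR R] (EFin \o f) ->
  \int[leb]_x f (t - x) = \int[leb]_x f x.
Proof.
move=> intf; congr fine.
have pushE (g : measurableTypeR R -> \bar R) :
  (\int[leb]_x g x = \int[pushforward leb (reflection t)]_x g x)%E.
  by apply: eq_measure_integral => A mA _; apply/esym; exact: lebesgue_measure_reflect.
rewrite [RHS]pushE integral_pushforward//; first exact: measurable_int intf.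
move: intf => /integrableP[mf intf]; apply/integrableP; split.
  exact: measurableT_comp.
apply: le_lt_trans intf; rewrite [leRHS]pushE ge0_integral_pushforward//.
exact: measurableT_comp.
Qed.

Lemma sgr_expRB (a b : R) : Num.sg (expR a - expR b) = Num.sg (a - b).
Proof.
have [ab|ab|->] := ltgtP a b; last by rewrite !subrr.
- by rewrite !ltr0_sg ?subr_lt0 ?ltr_expR.
- by rewrite !gtr0_sg ?subr_gt0 ?ltr_expR.
Qed.

(** Equal variances give equal peaks, so only exponents are compared; their difference is affine in
    [x] and vanishes at the midpoint of the means. *)
Lemma sgr_normal_pdfB m m' x :
  Num.sg (normal_pdf m 1 x - normal_pdf m' 1 x) =
  Num.sg ((m - m') * (x - (m + m') / 2)).
Proof.
rewrite !normal_pdfE ?oner_neq0// -mulrBr sgrM gtr0_sg ?normal_peak_gt0 ?oner_neq0//.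
rewrite mul1r sgr_expRB expr1n; congr Num.sg; lra.
Qed.

(* Reflection at t turns twice the integral into that of
   f * (normal_pdf m 1 - normal_pdf (2t - m) 1), and the sign of this integrand
   is that of m - t for every x <> t. *)
Lemma sgr_Rintegral_normal_prob m t f : bmeas f ->
  (forall x, f (t *+ 2 - x) = - f x) ->
  (forall x, Num.sg (f x) = Num.sg (x - t)) ->
  Num.sg (\int[normal_prob m 1]_x f x) = Num.sg (m - t).
Proof.
move=> bf fodd fsg.
pose m' := t *+ 2 - m.
have sqE x : (t *+ 2 - x - m) ^+ 2 = (x - m') ^+ 2 by rewrite /m'; lra.
(* Since [m'] mirrors [m] at [t], the midpoint is [t] and m - m' = 2(m - t): the product is twice a
   square. *)
have prodE x : (m - t) * ((x - t) * ((m - m') * (x - (m + m') / 2))) =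
  2 * ((m - t) ^+ 2 * (x - t) ^+ 2) by rewrite /m'; lra.
have I1 := integral_normal_prob m bf.
have I2 : \int[normal_prob m 1]_x f x = \int[leb]_x (- f x * normal_pdf m' 1 x).
  rewrite I1 -(@Rintegral_reflect (t *+ 2)); last exact: integrable_bmeas_normal_pdf.
  apply: eq_Rintegral => x _; rewrite fodd; congr (_ * _).
  rewrite !normal_pdfE ?oner_neq0//; congr (_ * _).
  by rewrite /normal_fun sqE.
set I := \int[_]_x _ in I1 I2 *.
have i1 := integrable_bmeas_normal_pdf m 1 bf.
have i2 := integrable_bmeas_normal_pdf m' 1 (bmeasN bf).
have II : I + I = \int[leb]_x (f x * (normal_pdf m 1 x - normal_pdf m' 1 x)).
  rewrite {1}I1 I2 -RintegralD//; apply: eq_Rintegral => x _.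
    by rewrite mulNr -mulrBr.
have [mt|mt] := eqVneq m t.
  rewrite mt subrr sgr0; apply/eqP; rewrite sgr_eq0.
  suff : I *+ 2 == 0 by rewrite mulrn_eq0.
  apply/eqP; rewrite mulr2n.
  rewrite II /m' mt mulr2n addrK.
  under eq_Rintegral do rewrite subrr mulr0.
  by rewrite /Rintegral integral0.
(* The factor [m - t] makes the integrand nonnegative for either sign of [m - t], which avoids a
   case distinction. *)
have : 0 < \int[leb]_x ((m - t) * (f x * (normal_pdf m 1 x - normal_pdf m' 1 x))).
  have sg0 x : Num.sg ((m - t) * (f x * (normal_pdf m 1 x - normal_pdf m' 1 x))) =
     Num.sg ((m - t) ^+ 2 * (x - t) ^+ 2).
    rewrite sgrM (sgrM (f x)) fsg sgr_normal_pdfB -!sgrM.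
    by rewrite prodE sgrM gtr0_sg// mul1r.
  apply: (@Rintegral_gt0 _ _ _ leb _ `]t, +oo[%classic).
  - apply: (@eq_integrable _ _ _ leb _ measurableT (fun x => (m - t)%:E *
      (f x * normal_pdf m 1 x + - f x * normal_pdf m' 1 x)%:E)%E).
      by move=> x _ /=; rewrite mulNr -mulrBr.
    by apply: integrableZl => //; exact: (integrableD measurableT i1 i2).
  - exact: measurable_itv.
  - by rewrite /= lebesgue_measure_itv/= ltry.
  - by move=> x; rewrite -sgr_ge0 sg0 sgr_ge0 mulr_ge0 ?sqr_ge0.
  - move=> x /=; rewrite in_itv/= andbT => xt.
    by rewrite -sgr_gt0 sg0 sgr_gt0 mulr_gt0// exprn_even_gt0//= subr_eq0// gt_eqF.
rewrite RintegralZl//; last first.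
  apply: (@eq_integrable _ _ _ leb _ measurableT (fun x =>
      (f x * normal_pdf m 1 x + - f x * normal_pdf m' 1 x)%:E)%E).
    by move=> x _ /=; rewrite mulNr -mulrBr.
  exact: (integrableD measurableT i1 i2).
rewrite -II -mulr2n mulrnAr pmulrn_lgt0// => mtI.
have [mt0|mt0|/eqP] := ltgtP (m - t) 0; last by rewrite subr_eq0 (negbTE mt).
- by rewrite !ltr0_sg// -(nmulr_rgt0 _ mt0).
- by rewrite !gtr0_sg// -(pmulr_rgt0 _ mt0).
Qed.

(* A crude bound on the variance of N(m, 1): since u exp(- u / 2) <= 4 exp(- u / 4),
   (x - m)^2 times the density of N(m, 1) is at most this constant times the
   density of N(m, 2). *)
Definition moment2_bound : R := 4 * normal_peak 1 / normal_peak (Num.sqrt 2).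

Lemma moment2_bound_ge0 : 0 <= moment2_bound.
Proof. by rewrite divr_ge0 ?mulr_ge0 ?normal_peak_ge0. Qed.

Lemma normal_pdf_moment2 m x :
  (x - m) ^+ 2 * normal_pdf m 1 x <= moment2_bound * normal_pdf m (Num.sqrt 2) x.
Proof.
have s2 : Num.sqrt 2 != 0 :> R by rewrite gt_eqF// sqrtr_gt0.
rewrite !normal_pdfE ?oner_neq0// /moment2_bound [leRHS]mulrA divfK;
  last by rewrite gt_eqF ?normal_peak_gt0.
rewrite mulrCA -[leRHS]mulrA [leRHS]mulrCA ler_pM2l ?normal_peak_gt0 ?oner_neq0//.
rewrite /normal_fun sqr_sqrtr// expr1n; set u := (x - m) ^+ 2.
have -> : - u / (1 *+ 2) = - u / (2 *+ 2) + - u / (2 *+ 2) by lra.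
rewrite expRD mulrA ler_pM2r ?expR_gt0//.
rewrite mulNr expRN ler_pdivrMr ?expR_gt0//.
(* The inequality 1 + v <= exp v at v = u/4 gives u <= 4 exp(u/4). *)
have := expR_ge1Dx (u / (2 *+ 2)); lra.
Qed.

(** Under the density, the quadratic term is dominated by a multiple of the wider density of N(m,
    2), which integrates to 1. *)
Lemma normal_prob_quadratic_le m f (a b : R) : bmeas f -> 0 <= b ->
  (forall x, f x <= a + b * (x - m) ^+ 2) ->
  \int[normal_prob m 1]_x f x <= a + b * moment2_bound.
Proof.
move=> bf b0 fab; rewrite integral_normal_prob//.
pose s : R := Num.sqrt 2.
have ia := integrable_bmeas_normal_pdf m 1 (bmeas_cst a).
have ib := integrable_bmeas_normal_pdf m s (bmeas_cst (b * moment2_bound)).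
have -> : a + b * moment2_bound = \int[leb]_x (a * normal_pdf m 1 x +
    b * moment2_bound * normal_pdf m s x).
  rewrite RintegralD// !RintegralZl ?Rintegral_normal_pdf ?mulr1//.
    exact: integrable_normal_pdf.
  exact: integrable_normal_pdf.
apply: le_Rintegral => //.
- exact: integrable_bmeas_normal_pdf.
- exact: (integrableD measurableT ia ib).
- move=> x _.
  have := fab x => /(ler_wpM2r (normal_pdf_ge0 m 1 x)) /le_trans; apply.
  rewrite mulrDl lerD2l -(mulrA b (_ ^+ 2)) -(mulrA b moment2_bound) ler_wpM2l//.
  exact: normal_pdf_moment2.
Qed.

Lemma measurable_sqr_gt (s : R) :
  measurable [set x : measurableTypeR R | s < x ^+ 2].
Proof.
have := @measurable_fun_ltr _ _ R [set: measurableTypeR R] (cst s)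
  (fun x => x ^+ 2) (measurable_cst _) (measurable_funX _ (@measurable_id _ _ _)).
by move=> /(_ measurableT [set true]); rewrite setTI; exact.
Qed.

Lemma normal_prob_sqr_gt m (s : R) :
  0 < \int[normal_prob m 1]_x (\1_[set x : measurableTypeR R | s < x ^+ 2] x : R).
Proof.
have bi := bmeas_indic (measurable_sqr_gt s) : bmeas (_ : _ -> R).
rewrite integral_normal_prob//.
(* Beyond |s| + 1 >= 1, x^2 > x > s. *)
apply: (@Rintegral_gt0 _ _ _ leb _ `]`|s| + 1, +oo[%classic).
- exact: integrable_bmeas_normal_pdf.
- exact: measurable_itv.
- by rewrite /= lebesgue_measure_itv/= ltry.
- by move=> x; rewrite mulr_ge0// normal_pdf_ge0.
- move=> x /=; rewrite in_itv/= andbT => sx.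
  have s1 := ler_norm s; have s0 := normr_ge0 s.
  rewrite indicE mem_set/=; last by nra.
  rewrite mul1r normal_pdfE ?oner_neq0// mulr_gt0 ?expR_gt0//.
  by rewrite normal_peak_gt0 ?oner_neq0.
Qed.

End normal1.

(** * Standard-covariance normal laws on R^d, by induction on the dimension *)

Section normal_row.
Context {R : realType}.
Notation V := (@moment2_bound R).

Lemma enorm2E d (x : 'rV[R]_d) : enorm2 x = \sum_(j < d) x ord0 j ^+ 2.
Proof. by rewrite /enorm2 sqr_sqrtr// sumr_ge0// => j _; exact: sqr_ge0. Qed.

Lemma enorm2_ge0 d (x : 'rV[R]_d) : 0 <= enorm2 x.
Proof. exact: sqr_ge0. Qed.

Lemma bmeas_row_cons d (f : 'rV[R]_(1 + d) -> R) :
  bmeas f -> bmeas (fun p => f (row_cons p)).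
Proof.
by move=> bf; exact: bmeas_comp (@measurable_funPT _ _ _ _ (@row_cons R d)) bf.
Qed.

(** Both orders of integration are provided: the tail is innermost when the induction hypothesis is
    applied to it, the first coordinate when a one-dimensional result is. *)
Lemma normal_row_fubini1 d (mu : 'rV[R]_(1 + d)) (f : 'rV[R]_(1 + d) -> R) :
  bmeas f ->
  \int[@normal_row R d.+1 mu]_x f x = \int[normal_prob (mu ord0 ord0) 1]_x
    \int[normal_row (rsubmx mu)]_y f (row_cons (x, y)).
Proof.
move=> bf; rewrite -(bmeas_fubini1 _ _ (bmeas_row_cons bf)).
exact: bmeas_Rintegral_distribution.
Qed.

Lemma normal_row_fubini2 d (mu : 'rV[R]_(1 + d)) (f : 'rV[R]_(1 + d) -> R) :
  bmeas f ->
  \int[@normal_row R d.+1 mu]_x f x = \int[normal_row (rsubmx mu)]_y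
    \int[normal_prob (mu ord0 ord0) 1]_x f (row_cons (x, y)).
Proof.
move=> bf; rewrite -(bmeas_fubini2 _ _ (bmeas_row_cons bf)).
exact: bmeas_Rintegral_distribution.
Qed.

Lemma bmeas_normal_row_fst d (mu : 'rV[R]_(1 + d)) (f : 'rV[R]_(1 + d) -> R) :
  bmeas f ->
  bmeas (fun x => \int[normal_row (rsubmx mu)]_y f (row_cons (x, y))).
Proof.
move=> /bmeas_row_cons bf.
(* [normal_prob 0 1] is an arbitrary choice of law for the coordinate that stays free. *)
exact: (bmeas_Rintegral_fst (normal_prob 0 1) (normal_row (rsubmx mu)) bf).
Qed.

Lemma bmeas_normal_row_snd d m (f : 'rV[R]_(1 + d) -> R) : bmeas f ->
  bmeas (fun y : 'rV[R]_d => \int[normal_prob m 1]_x f (row_cons (x, y))).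
Proof.
move=> /bmeas_row_cons bf.
exact: (bmeas_Rintegral_snd (normal_prob m 1) (normal_row 0) bf).
Qed.

Lemma lshift_ord0 d : lshift d (ord0 : 'I_1) = ord0 :> 'I_(1 + d).
Proof. exact: val_inj. Qed.

Lemma row_cons0 d (p : measurableTypeR R * 'rV[R]_d) :
  row_cons p ord0 (lshift d ord0) = p.1.
Proof. by rewrite row_mxEl mxE eqxx mulr1n. Qed.

Lemma row_consr d (p : measurableTypeR R * 'rV[R]_d) k :
  row_cons p ord0 (rshift 1 k) = p.2 ord0 k.
Proof. by rewrite row_mxEr. Qed.

Lemma enorm2_row_consB d (p : measurableTypeR R * 'rV[R]_d) (mu : 'rV_(1 + d)) :
  enorm2 (row_cons p - mu) =
  (p.1 - mu ord0 (lshift d ord0)) ^+ 2 + enorm2 (p.2 - rsubmx mu).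
Proof.
rewrite !enorm2E big_split_ord/= big_ord_recl big_ord0 addr0.
have subE k (x y : 'rV[R]_k) j : (x - y) ord0 j = x ord0 j - y ord0 j.
  by rewrite !mxE.
rewrite subE row_cons0; congr (_ + _).
by apply: eq_bigr => k _; rewrite !subE row_consr mxE.
Qed.

(* Stated for bounded f, so that no integral of an unbounded function occurs. *)
Lemma normal_row_quadratic_le d (mu : 'rV[R]_d) (f : 'rV[R]_d -> R) (a b : R) :
  bmeas f -> 0 <= b -> (forall x, f x <= a + b * enorm2 (x - mu)) ->
  \int[normal_row mu]_x f x <= a + b * (d%:R * V).
Proof.
elim: d mu f a => [|d IH] mu f a bf b0 fab.
  rewrite mul0r mulr0 addr0 -[leRHS](Rintegral_prob_cst (normal_row mu)).
  apply: bmeas_le_Rintegral => //; first exact: bmeas_cst.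
  by move=> x; rewrite (le_trans (fab x))// enorm2E big_ord0 mulr0 addr0.
rewrite normal_row_fubini1//.
have bf' := bmeas_row_cons bf.
apply: (@le_trans _ _ ((a + b * (d%:R * V)) + b * V)); last by rewrite -natr1; lra.
apply: normal_prob_quadratic_le => //; first exact: bmeas_normal_row_fst.
move=> x.
apply: (@le_trans _ _ (a + b * (x - mu ord0 ord0) ^+ 2 + b * (d%:R * V))); last first.
  by rewrite addrAC.
apply: IH => //; first exact: (bmeas_section1 bf').
move=> y; apply: le_trans (fab _) _; rewrite enorm2_row_consB lshift_ord0/=.

by rewrite mulrDr addrA.
Qed.

Definition flip d (t : R) (j : 'I_d) (x : 'rV[R]_d) : 'rV[R]_d :=
  \row_k (if k == j then t *+ 2 - x ord0 k else x ord0 k).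

Lemma flip_row_cons0 d t (p : measurableTypeR R * 'rV[R]_d) :
  flip t (lshift d ord0) (row_cons p) = row_cons (t *+ 2 - p.1, p.2).
Proof.
apply/rowP => i; rewrite [LHS]mxE.
case: (@split_ordP 1 d i) => k ->; last by rewrite !row_consr eq_rlshift.
have -> : k = ord0 by exact: ord1.
by rewrite !row_cons0 eqxx.
Qed.

Lemma flip_row_consr d t k (p : measurableTypeR R * 'rV[R]_d) :
  flip t (rshift 1 k) (row_cons p) = row_cons (p.1, flip t k p.2).
Proof.
apply/rowP => i; rewrite [LHS]mxE.
case: (@split_ordP 1 d i) => j ->; last by rewrite !row_consr mxE eq_rshift.
have -> : j = ord0 by exact: ord1.
by rewrite !row_cons0 eq_lrshift.
Qed.

Lemma sgr_Rintegral_normal_row d (mu : 'rV[R]_d) (t : R) j (f : 'rV[R]_d -> R) :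
  bmeas f -> (forall x, f (flip t j x) = - f x) ->
  (forall x, Num.sg (f x) = Num.sg (x ord0 j - t)) ->
  Num.sg (\int[normal_row mu]_x f x) = Num.sg (mu ord0 j - t).
Proof.
elim: d mu f j => [|d IH] mu f j bf fodd fsg; first by case: j fodd fsg.
have bf' := bmeas_row_cons bf.
case: (@split_ordP 1 d j) => k jk; subst j.
- rewrite normal_row_fubini2//.
  apply: sgr_Rintegral; first exact: bmeas_normal_row_snd.
  move=> y; rewrite [k]ord1 lshift_ord0.
  
  apply: sgr_Rintegral_normal_prob => [|x|x]; first exact: (bmeas_section2 bf').
  + by rewrite -fodd [k]ord1 flip_row_cons0.
  + by rewrite fsg [k]ord1 row_cons0.
- rewrite normal_row_fubini1//.
  apply: sgr_Rintegral; first exact: bmeas_normal_row_fst.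
  move=> x.
  rewrite (_ : mu ord0 (rshift 1 k) = rsubmx (mu : 'rV_(1 + d)) ord0 k);
    last by rewrite mxE.
  apply: IH => [|y|y]; first exact: (bmeas_section1 bf').
  + by rewrite -fodd flip_row_consr.
  + by rewrite fsg row_consr.
Qed.

End normal_row.

(** * The weight: positivity, decay, and its Gaussian means *)

Section weight.
Context {R : realType}.
Notation V := (@moment2_bound R).

Lemma measurable_enorm2_gt d (s : R) :
  measurable [set x : 'rV[R]_d | s < enorm2 x].
Proof.
have := @measurable_fun_ltr _ _ R [set: 'rV[R]_d] (cst s)
  (@enorm2 R d) (measurable_cst _) (@measurable_funPT _ _ _ _ (@enorm2 R d)).
by move=> /(_ measurableT [set true]); rewrite setTI; exact.
Qed.

(** The event contains the cylinder on which the square of the first coordinate alone exceeds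
    [s]. *)
Lemma normal_row_enorm2_gt d (mu : 'rV[R]_d) (s : R) : (0 < d)%N ->
  0 < \int[normal_row mu]_x (\1_[set x | s < enorm2 x] x : R).
Proof.
case: d mu => // d mu _.
have bi := @bmeas_indic _ _ R _ (@measurable_enorm2_gt d.+1 s).
have bi' := bmeas_row_cons bi.
rewrite normal_row_fubini2// -sgr_gt0.
rewrite (@sgr_Rintegral _ _ _ _ _ 1) ?ltr01 ?sgr_gt0//; last move=> y.
  exact: bmeas_normal_row_snd.
rewrite sgr1 gtr0_sg//.
apply: lt_le_trans (normal_prob_sqr_gt (mu ord0 ord0) s) _.
apply: bmeas_le_Rintegral.
- exact: bmeas_indic (measurable_sqr_gt s).
- exact: (bmeas_section2 bi').
- move=> x; rewrite !indicE; have [xs|] := boolP (x \in _); last by [].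
  rewrite mem_set//=; move: xs; rewrite inE/= => /lt_le_trans; apply.
  by rewrite -[row_cons _]subr0 enorm2_row_consB/= mxE subr0 lerDl enorm2_ge0.
Qed.

Definition weight_row d (z : 'rV[R]_d) : R := weight d (enorm2 z).

(** The tail event defining the weight, taken jointly in z and the Gaussian vector: Fubini then
    makes the weight measurable in z. *)
Definition pair_gt d : set ('rV[R]_d * 'rV[R]_d) :=
  [set p | enorm2 p.1 / 2 < enorm2 p.2].

Lemma measurable_pair_gt d : measurable (@pair_gt d).
Proof.
have m := @measurable_funPT _ _ _ _ (@enorm2 R d).
have := @measurable_fun_ltr _ _ R [set: 'rV[R]_d * 'rV[R]_d]
  (fun p => enorm2 p.1 / 2) (fun p => enorm2 p.2).
move=> /(_ _ _ measurableT [set true]); rewrite setTI; apply=> //.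
  apply: measurable_funM => //.
  by apply: measurableT_comp m _; exact: measurable_fst.
by apply: measurableT_comp m _; exact: measurable_snd.
Qed.

Lemma weight_row_indic d (z : 'rV[R]_d) :
  weight_row z = \int[normal_row (0 : 'rV[R]_d)]_x
          (\1_[set x | enorm2 z / 2 < enorm2 x] x : R).
Proof.
have mA := @measurable_enorm2_gt d (enorm2 z / 2).
rewrite Rintegral_indic_prob// /weight_row /weight /marcumQ /noncentral_chi2_cdf.
rewrite /noncentral_chi2 sqr_sqrtr ?divr_ge0 ?enorm2_ge0//.
rewrite (_ : \row_j _ = 0); last first.
  by apply/rowP => j; rewrite !mxE expr0n/= sqrtr0 if_same.
change (1 - fine (normal_row (0 : 'rV[R]_d)
    (@enorm2 R d @^-1` `]-oo, enorm2 z / 2]%classic)) =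
  fine (normal_row (0 : 'rV[R]_d) [set x | enorm2 z / 2 < enorm2 x])).
rewrite (_ : @enorm2 R d @^-1` _ = ~` [set x | enorm2 z / 2 < enorm2 x]); last first.
  by apply/seteqP; split => x /=; rewrite in_itv/= leNgt => /negP.
rewrite probability_setC// fineB ?fin_num_measure//=.
by rewrite opprB addrC subrK.
Qed.

Lemma weight_row_pair d (z : 'rV[R]_d) :
  weight_row z = \int[normal_row (0 : 'rV[R]_d)]_x (\1_(@pair_gt d) (z, x) : R).
Proof.
rewrite weight_row_indic; apply: eq_Rintegral => x _; rewrite !indicE.
by congr ((nat_of_bool _)%:R); apply/idP/idP; rewrite !inE.
Qed.

Lemma weight_row_ge0 d (z : 'rV[R]_d) : 0 <= weight_row z.
Proof. by rewrite weight_row_indic Rintegral_ge0. Qed.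

Lemma weight_row_gt0 d (z : 'rV[R]_d) : (0 < d)%N -> 0 < weight_row z.
Proof. by move=> d0; rewrite weight_row_indic normal_row_enorm2_gt. Qed.

Lemma weight_row_le1 d (z : 'rV[R]_d) : weight_row z <= 1.
Proof.
rewrite weight_row_indic -(Rintegral_prob_cst (normal_row (0 : 'rV[R]_d)) 1).
apply: bmeas_le_Rintegral.
- exact: (bmeas_indic (measurable_enorm2_gt _)).
- exact: bmeas_cst.
- by move=> x; rewrite indicE; case: (_ \in _).
Qed.

Lemma bmeas_weight_row d : bmeas (@weight_row d).
Proof.
rewrite (_ : @weight_row d = fun z => \int[normal_row (0 : 'rV[R]_d)]_x
    (\1_(@pair_gt d) (z, x) : R)); last by apply/funext => z; exact: weight_row_pair.
apply: (bmeas_Rintegral_fst (normal_row (0 : 'rV[R]_d))).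
exact: (bmeas_indic (@measurable_pair_gt d)).
Qed.

(** Chebyshev in pointwise form: [enorm2 z] times the indicator of the tail event is at most
    [2 * enorm2 x]. *)
Lemma weight_row_enorm2_le d (z : 'rV[R]_d) : weight_row z * enorm2 z <= 2 * (d%:R * V).
Proof.
have bi := @bmeas_indic _ _ R _ (@measurable_enorm2_gt d (enorm2 z / 2)).
rewrite weight_row_indic mulrC -bmeas_RintegralZl// -[leRHS]add0r.
apply: normal_row_quadratic_le => //.
  by apply: bmeasM => //; exact: bmeas_cst.
move=> x; rewrite add0r subr0 indicE.
have [xz|_] := boolP (x \in _); last by rewrite mulr0 mulr_ge0 ?enorm2_ge0.
by move: xz; rewrite inE/= => xz; rewrite mulr1; lra.
Qed.

Lemma sqr_coord_le d (z : 'rV[R]_d) j : z ord0 j ^+ 2 <= enorm2 z.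
Proof.
rewrite enorm2E (bigD1 j)//= lerDl sumr_ge0// => k _; exact: sqr_ge0.
Qed.

Lemma weight_row_coord_sqr_le d (z : 'rV[R]_d) j :
  (weight_row z * z ord0 j) ^+ 2 <= 2 * (d%:R * V) * weight_row z.
Proof.
rewrite (_ : _ ^+ 2 = weight_row z * z ord0 j ^+ 2 * weight_row z); last by lra.
rewrite ler_wpM2r ?weight_row_ge0//.
apply: le_trans (weight_row_enorm2_le z).
by rewrite ler_wpM2l ?weight_row_ge0// sqr_coord_le.
Qed.

Lemma dV_ge0 d : 0 <= d%:R * V.
Proof. by rewrite mulr_ge0 ?moment2_bound_ge0. Qed.

(** The decay of the weight beats the growth of the coordinate. The square is at most v = 2dV
    because the weight is at most 1, whence the bound 1 + v on the absolute value. *)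
Lemma bmeas_weight_row_coord d j : bmeas (fun z : 'rV[R]_d => weight_row z * z ord0 j).
Proof.
split.
  by apply: measurable_funM; [case: (@bmeas_weight_row d)|exact: measurable_coord].
exists (1 + 2 * (d%:R * V)) => z.
have V0 : 0 <= 2 * (d%:R * V) by have := dV_ge0 d; lra.
have := weight_row_coord_sqr_le z j; rewrite -real_normK ?num_real//.
set a := `|_|; have a0 : 0 <= a by exact: normr_ge0.
set v := 2 * (d%:R * V) in V0 *.
have := weight_row_le1 z; have := weight_row_ge0 z; nra.
Qed.

Lemma measurable_subr d (th : 'rV[R]_d) :
  measurable_fun [set: 'rV[R]_d] (fun x => x - th).
Proof.
apply: measurable_fun_row => j; under eq_fun do rewrite !mxE.
by apply: measurable_funD => //; exact: measurable_coord.
Qed.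

(** For [mu] = theta_k this is H_k; [weight_mean_coord] is the [j]-th coordinate of G_k. *)
Definition weight_mean d (th mu : 'rV[R]_d) : R :=
  \int[normal_row mu]_x weight_row (x - th).

Definition weight_mean_coord d (th mu : 'rV[R]_d) j : R :=
  \int[normal_row mu]_x (weight_row (x - th) * (x - th) ord0 j).

Lemma bmeas_weight_rowB d (th : 'rV[R]_d) :
  bmeas (fun x : 'rV[R]_d => weight_row (x - th)).
Proof. exact: bmeas_comp (measurable_subr th) (@bmeas_weight_row d). Qed.

Lemma bmeas_weight_row_coordB d (th : 'rV[R]_d) j :
  bmeas (fun x : 'rV[R]_d => weight_row (x - th) * (x - th) ord0 j).
Proof. exact: bmeas_comp (measurable_subr th) (@bmeas_weight_row_coord d j). Qed.

Lemma weight_mean_gt0 d (th mu : 'rV[R]_d) : (0 < d)%N -> 0 < weight_mean th mu.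
Proof.
move=> d0; rewrite -sgr_gt0 (@sgr_Rintegral _ _ _ _ _ 1) ?sgr_gt0//.
  exact: bmeas_weight_rowB.
by move=> x; rewrite sgr1 gtr0_sg// weight_row_gt0.
Qed.

Lemma sgr_weight_mean_coord d (th mu : 'rV[R]_d) j : (0 < d)%N ->
  Num.sg (weight_mean_coord th mu j) = Num.sg (mu ord0 j - th ord0 j).
Proof.
move=> d0; apply: sgr_Rintegral_normal_row => [|x|x].
- exact: bmeas_weight_row_coordB.
- have flipE k : (flip (th ord0 j) j x - th) ord0 k =
      if k == j then - (x - th) ord0 k else (x - th) ord0 k.
    by rewrite !mxE; case: eqP => // ->; lra.
  rewrite flipE eqxx mulrN; congr (- (_ * _)); congr weight.
  by rewrite !enorm2E; apply: eq_bigr => k _; rewrite flipE; case: eqP; rewrite ?sqrrN.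
- by rewrite sgrM gtr0_sg ?weight_row_gt0// mul1r !mxE.
Qed.

(** The factors are the 2 of Peetre's inequality, a bound on the weight times 1 + |x - th|^2, and a
    bound for the mean of 1 + |x - mu|^2. *)
Definition decay_bound d : R :=
  2 * (1 + 2 * (d%:R * V)) * (1 + d%:R * V).

(* Peetre's inequality 1 + |mu - th|^2 <= 2 (1 + |x - th|^2) (1 + |x - mu|^2)
   transfers the decay of the weight around th to a function centred at mu. *)
Lemma weight_mean_le d (th mu : 'rV[R]_d) :
  weight_mean th mu <= decay_bound d / (1 + enorm2 (mu - th)).
Proof.
have V0 : 0 <= d%:R * V by have := dV_ge0 d; lra.
have e0 := enorm2_ge0 (mu - th).
pose b := 2 * (1 + 2 * (d%:R * V)) / (1 + enorm2 (mu - th)).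
have b0 : 0 <= b by rewrite divr_ge0//; lra.
have -> : decay_bound d / (1 + enorm2 (mu - th)) = b + b * (d%:R * V).
  by rewrite /decay_bound mulrAC -/b mulrDr mulr1.
apply: normal_row_quadratic_le => //; first exact: bmeas_weight_rowB.
move=> x.
have peetre : 1 + enorm2 (mu - th) <= 2 * (1 + enorm2 (x - th)) * (1 + enorm2 (x - mu)).
  have : enorm2 (mu - th) <= 2 * enorm2 (x - th) + 2 * enorm2 (x - mu).
    rewrite !enorm2E !mulr_sumr -big_split/=; apply: ler_sum => j _.
    rewrite !mxE; have := sqr_ge0 (x ord0 j - th ord0 j + (x ord0 j - mu ord0 j)); lra.
  have := mulr_ge0 (enorm2_ge0 (x - th)) (enorm2_ge0 (x - mu)); lra.
have W1 : weight_row (x - th) * (1 + enorm2 (x - th)) <= 1 + 2 * (d%:R * V).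
  rewrite mulrDr mulr1; apply: lerD; [exact: weight_row_le1|exact: weight_row_enorm2_le].
have -> : b + b * enorm2 (x - mu) = b * (1 + enorm2 (x - mu)) by lra.
rewrite /b mulrAC ler_pdivlMr; last by lra.
have := weight_row_ge0 (x - th) => /ler_wpM2l/(_ _ _ peetre)/le_trans; apply.
rewrite -/(weight_row (x - th)).
have x0 : 0 <= 1 + enorm2 (x - mu) by have := enorm2_ge0 (x - mu); lra.
have := ler_wpM2r x0 W1; lra.
Qed.

(** By Jensen and the pointwise bound, G_k inherits its decay from H_k. *)
Lemma weight_mean_coord_sqr_le d (th mu : 'rV[R]_d) j :
  weight_mean_coord th mu j ^+ 2 <= 2 * (d%:R * V) * weight_mean th mu.
Proof.
apply: le_trans (sqr_Rintegral_le _ (bmeas_weight_row_coordB th j)) _.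
rewrite -bmeas_RintegralZl; last exact: bmeas_weight_rowB.
apply: bmeas_le_Rintegral.
- under eq_fun do rewrite expr2.
  by apply: bmeasM; exact: bmeas_weight_row_coordB.
- by apply: bmeasM; [exact: bmeas_cst|exact: bmeas_weight_rowB].
- by move=> x; exact: weight_row_coord_sqr_le.
Qed.

End weight.

(** * Limits of vectors and sums, and the filter of the outer limit *)

Section limits.
Context {R : realType}.

Lemma cvg_row {T : Type} (F : set_system T) (FF : Filter F) d
    (f : T -> 'rV[R]_d) (l : 'rV[R]_d) :
  (forall j, f x ord0 j @[x --> F] --> l ord0 j) -> f x @[x --> F] --> l.
Proof.
move=> fl; apply/cvg_ballP => e e0.
have : \forall x \near F, forall j, ball (l ord0 j) e (f x ord0 j).
  by apply: filter_forall => j; move/cvg_ballP : (fl j); exact.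
by apply: filterS => x xl; split => // i j; rewrite ord1.
Qed.

Lemma cvg_sum_ord {T : Type} (F : set_system T) (FF : Filter F) K
    (f : 'I_K -> T -> R) (l : 'I_K -> R) :
  (forall k, f k x @[x --> F] --> l k) ->
  \sum_(k < K) f k x @[x --> F] --> \sum_(k < K) l k.
Proof. by move=> fl; apply: cvg_big => //; exact: add_continuous. Qed.

Lemma cvg_ratio_infty (a : nat -> nat) (al : R) : 0 < al ->
  (a N)%:R / N%:R @[N --> \oo] --> al -> a N @[N --> \oo] --> \oo.
Proof.
move=> al0 aal; apply/cvgnyPge => A.
have al2 : 0 < al / 2 by rewrite divr_gt0.
have /cvgrPdist_lt/(_ _ al2) h := aal.
near=> N.
have N0 : 0 < N%:R :> R by rewrite ltr0n; near: N; exact: nbhs_infty_gt.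
have NA : A%:R / (al / 2) <= N%:R :> R by near: N; exact: nbhs_infty_ger.
have : `|al - (a N)%:R / N%:R| < al / 2 by near: N.
rewrite ltr_norml => /andP[_ h1].
have : al / 2 * N%:R < (a N)%:R.
  by rewrite -ltr_pdivlMr//; lra.
rewrite ler_pdivrMr// mulrC in NA.
by move=> /(le_lt_trans NA); rewrite ltr_nat => /ltnW.
Unshelve. all: by end_near. Qed.

(** Properness makes limits along this filter unique, so that a zero outer limit says something
    about G_i / H_i. *)
Lemma others_to_infty_proper d K (i : 'I_K) (th : 'rV[R]_d) : (0 < d)%N ->
  ProperFilter (others_to_infty i th).
Proof.
move=> d0; apply: filter_from_proper.
  apply: filter_from_filter; first by exists 0.
  move=> M1 M2 _ _; exists (Num.max M1 M2) => // c [ic ci cM].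
  by split; split => // k /cM; rewrite ge_max => /andP[].
move=> M _; pose e : 'rV[R]_d := const_mx 1.
(* The centroids are spread along the diagonal through [th]. The factor k+1, rather than k, keeps
   index 0 away from [th], and |M| + 1 > 0 keeps the multiples distinct. *)
pose a (k : 'I_K) : R := if k == i then 0 else k.+1%:R * (`|M| + 1).
have M0 := normr_ge0 M.
exists (fun k => th + a k *: e); split.
- have ainj : injective a.
    move=> k l; rewrite /a; have [->|ki] := eqVneq k i; have [->|li] := eqVneq l i => //.
    + by move/esym/eqP; rewrite mulf_eq0 pnatr_eq0/= gt_eqF//; lra.
    + by move/eqP; rewrite mulf_eq0 pnatr_eq0/= gt_eqF//; lra.
    + move/mulIf => /(_ _)/eqP; rewrite eqr_nat eqSS => h.
      by apply/val_inj/eqP/h; rewrite gt_eqF//; lra.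
  move=> k l /= /addrI /rowP /(_ (Ordinal d0)); rewrite !mxE !mulr1.
  exact: ainj.
- by rewrite /a eqxx scale0r addr0.
- move=> k ki; rewrite addrC addKr /a (negbTE ki).
  apply: (@le_trans _ _ `|M|); first exact: ler_norm.
  have : `|M| ^+ 2 <= enorm ((k.+1%:R * (`|M| + 1)) *: e) ^+ 2.
    rewrite -/(enorm2 _); apply: le_trans (sqr_coord_le _ (Ordinal d0)).
    have M1 : 0 <= k.+1%:R * (`|M| + 1) by rewrite mulr_ge0//; lra.
    rewrite !mxE mulr1 ler_sqr ?nnegrE//.
    rewrite -natr1 mulrDl mul1r; have : 0 <= k%:R * (`|M| + 1) by rewrite mulr_ge0//; lra.
    lra.
  by rewrite ler_sqr// nnegrE sqrtr_ge0.
Qed.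

End limits.

(** * The inner limit for fixed centroids *)

Section sample.
Context {R : realType} {d K : nat}.
Context {disp : measure_display} {Om : measurableType disp}.
Variables (P : probability Om R) (Y : 'I_K -> nat -> {RV P >-> 'rV[R]_d}).
Variable c : 'I_K -> 'rV[R]_d.
Hypothesis Ylaw : forall k n A, measurable A ->
  distribution P (Y k n) A = normal_row (c k) A.
Hypothesis Yindep : mutually_independent (fun kn : 'I_K * nat => Y kn.1 kn.2).

Lemma sample_Rintegral k n (f : 'rV[R]_d -> R) : bmeas f ->
  \int[P]_x f (Y k n x) = \int[normal_row (c k)]_x f x.
Proof.
move=> bf; rewrite -(bmeas_Rintegral_distribution (Y k n) bf).
by apply: eq_measure_Rintegral => A mA; exact: Ylaw.
Qed.

Lemma sample_independent k n p A B : n != p -> measurable A -> measurable B ->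
  P (Y k n @^-1` A `&` Y k p @^-1` B) =
  (P (Y k n @^-1` A) * P (Y k p @^-1` B))%E.
Proof.
move=> np mA mB.
have knp : (k, n) != (k, p) by apply: contra_neq np => -[].
have := Yindep (J := [fset (k, n); (k, p)]%fset)
  (A := fun kn => if kn == (k, n) then A else B).
rewrite big_fsetU1 ?inE//= big_seq_fset1 eqxx (negbTE (_ : (k, p) != (k, n))) 1?eq_sym//.
move=> <-; last by move=> kn _; case: ifP.
congr (P _); apply/seteqP; split => x /=.
  move=> [xA xB] kn /=; rewrite !inE => /orP[] /eqP ->; rewrite ?eqxx//.
  by rewrite eq_sym (negbTE knp).
move=> h; split.
  by have := h (k, n); rewrite /= !inE eqxx; exact.
have := h (k, p); rewrite /= !inE eqxx orbT eq_sym (negbTE knp); exact.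
Qed.

Lemma sample_slln k (f : 'rV[R]_d -> R) : bmeas f ->
  {ae P, forall x, (\sum_(n < N) f (Y k n x)) / N%:R @[N --> \oo] -->
    \int[normal_row (c k)]_x f x}.
Proof.
move=> bf; have [mf [C fC]] := bf.
apply: (@slln _ _ _ P (fun n x => f (Y k n x)) C).
- by move=> n; apply: measurableT_comp.
- by move=> n x; exact: fC.
- by move=> n; exact: sample_Rintegral.
- move=> n p np; rewrite independent_Rintegral_mul//.
    by rewrite !sample_Rintegral.
  by move=> A B; exact: sample_independent.
Qed.

Variables (Ns : nat -> 'I_K -> nat) (alpha : 'I_K -> R).
Hypothesis alpha0 : forall k, 0 < alpha k.
Hypothesis Ns_alpha : forall k, (Ns N k)%:R / N%:R @[N --> \oo] --> alpha k.

(** Each cluster contributes N_k/N times its own average; N_k tends to infinity because alpha_k > 0,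
    so the law of large numbers can be composed with it. *)
Lemma mixture_slln (f : 'rV[R]_d -> R) : bmeas f ->
  {ae P, forall x,
    (\sum_(k < K) \sum_(n < Ns N k) f (Y k n x)) / N%:R @[N --> \oo] -->
    \sum_(k < K) alpha k * \int[normal_row (c k)]_x f x}.
Proof.
move=> bf.
have : {ae P, forall x, forall k,
    (\sum_(n < N) f (Y k n x)) / N%:R @[N --> \oo] -->
    \int[normal_row (c k)]_x f x}.
  by apply: filter_forall => k; exact: sample_slln.
apply: filterS => x xf.
under eq_fun do rewrite mulr_suml.
apply: cvg_sum_ord => k.
have h1 := cvg_comp _ _ (cvg_ratio_infty (alpha0 k) (Ns_alpha (k := k))) (xf k).
have h2 := cvgM (Ns_alpha (k := k)) h1.
rewrite (_ : (fun N => _) = (fun N => (Ns N k)%:R / N%:R *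
  ((\sum_(n < Ns N k) f (Y k n x)) / (Ns N k)%:R))); first exact: h2.
apply/funext => N; have [->|N0] := eqVneq (Ns N k) 0%N.
  by rewrite big_ord0 !mul0r.
by rewrite [RHS]mulrC [RHS]mulrA divfK ?pnatr_eq0.
Qed.

Lemma weighted_mean_cvg (th : 'rV[R]_d) (k0 : 'I_K) : (0 < d)%N ->
  {ae P, forall x,
    weighted_mean (fun k n => Y k n x) (Ns N) th - th @[N --> \oo] -->
    \row_j ((\sum_(k < K) alpha k * weight_mean_coord th (c k) j) /
            (\sum_(k < K) alpha k * weight_mean th (c k)))}.
Proof.
move=> d0.
(* The index [k0] provides a term, so the sum is not empty. *)
have D0 : 0 < \sum_(k < K) alpha k * weight_mean th (c k).
  rewrite (bigD1 k0)//= ltr_wpDr//.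
    by rewrite sumr_ge0// => k _; rewrite mulr_ge0// ltW// weight_mean_gt0.
  by rewrite mulr_gt0// weight_mean_gt0.
have hA : {ae P, forall x, forall j,
    (\sum_(k < K) \sum_(n < Ns N k) weight_row (Y k n x - th) * (Y k n x - th) ord0 j)
      / N%:R @[N --> \oo] -->
    \sum_(k < K) alpha k * weight_mean_coord th (c k) j}.
  apply: filter_forall => j.
  exact: (mixture_slln (bmeas_weight_row_coordB th j)).
have hD := mixture_slln (bmeas_weight_rowB th).
apply: filterS2 hA hD => x xA xD.
apply: cvg_row => j; rewrite mxE.
apply: cvg_trans (cvgM (xA j) (cvgV _ xD)); last by rewrite gt_eqF.
apply: near_eq_cvg; near=> N.
rewrite /=.
have N0 : N%:R != 0 :> R by rewrite pnatr_eq0 -lt0n; near: N; exact: nbhs_infty_gt.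
set A := \sum_(k < K) \sum_(n < Ns N k) _ * _.
set D := \sum_(k < K) \sum_(n < Ns N k) weight_row _.
have Dpos : 0 < D / N%:R.
  by rewrite /D; near: N; exact: (cvgr_gt _ xD).
have Dn0 : D != 0 by apply: contraTneq Dpos => ->; rewrite mul0r ltxx.
(* Writing each sample point as (y - th) + th splits the numerator into the centred sum and [D]
   times [th]. *)
have -> : (weighted_mean (fun k n => Y k n x) (Ns N) th - th) ord0 j =
    D^-1 * (A + D * th ord0 j) - th ord0 j.
  rewrite /weighted_mean !mxE; congr (_ * _ - _).
  rewrite summxE /A /D mulr_suml -big_split/=; apply: eq_bigr => k _.
  rewrite summxE mulr_suml -big_split/=; apply: eq_bigr => n _.
  by rewrite !mxE -mulrDr subrK.
by rewrite mulrDr mulKf// addrK invf_div mulrA divfK// mulrC.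
Unshelve. all: by end_near. Qed.

End sample.

(** * The outer limit as the other centroids go to infinity *)

Section outer_limit.
Context {R : realType} {d K : nat}.
Variables (i : 'I_K) (thi th : 'rV[R]_d).
Hypothesis d0 : (0 < d)%N.
Notation F := (others_to_infty i thi).

Lemma cvg_weight_mean_infty k : k != i -> weight_mean th (c k) @[c --> F] --> (0 : R).
Proof.
have FF := others_to_infty_proper i thi d0.
move=> ki; apply/cvgrPdist_le => e e0.
pose B := decay_bound (R := R) d.
(* As M >= 1, a distance of at least M has a square of at least M. By |a - b|^2 <= 2|a|^2 + 2|b|^2,
   recentring from [thi] to [th] still leaves at least |B|/e. *)
pose M := 1 + 2 * (enorm2 (thi - th) + `|B| / e).
have M0 : 0 <= `|B| / e by rewrite divr_ge0// ltW.
exists M => // c [_ ci cM] /=.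
have en0 := enorm2_ge0 (thi - th).
have h : M <= enorm2 (c k - thi).
  rewrite /enorm2; have := cM k ki; set a := enorm _ => Ma.
  have : 1 <= a by rewrite (le_trans _ Ma)// /M; lra.
  by move=> a1; nra.
have hk : enorm2 (c k - thi) <= 2 * enorm2 (c k - th) + 2 * enorm2 (thi - th).
  rewrite !enorm2E !mulr_sumr -big_split/=; apply: ler_sum => j _.
  rewrite !mxE; have := sqr_ge0 (c k ord0 j - th ord0 j + (thi ord0 j - th ord0 j)); lra.
rewrite sub0r normrN ger0_norm ?(ltW (weight_mean_gt0 _ _ _))//.
apply: le_trans (weight_mean_le _ _) _.
have hB : `|B| / e <= enorm2 (c k - th) by rewrite /M in h; lra.
have p1 : 0 < 1 + enorm2 (c k - th) by have := enorm2_ge0 (c k - th); lra.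
rewrite ler_pdivrMr// -/B; rewrite ler_pdivrMr// in hB.
have := ler_norm B; lra.
Qed.

Lemma cvg_weight_mean_coord_infty k j : k != i ->
  weight_mean_coord th (c k) j @[c --> F] --> (0 : R).
Proof.
have FF := others_to_infty_proper i thi d0.
move=> ki; have h := cvg_weight_mean_infty ki.
pose b : R := 2 * (d%:R * moment2_bound).
have hb : b * weight_mean th (c k) @[c --> F] --> (0 : R).
  by rewrite -[0](mulr0 b); apply: cvgM => //; exact: cvg_cst.
apply/cvgrPdist_le => e e0.
have e2 : 0 < e ^+ 2 by rewrite exprn_gt0.
have /cvgrPdist_le/(_ _ e2) := hb.
apply: filterS => c; rewrite !sub0r !normrN => hc.
rewrite -ler_sqr ?nnegrE ?(ltW e0)// real_normK ?num_real//.
apply: le_trans (weight_mean_coord_sqr_le _ _ _) _; rewrite -/b.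
exact: le_trans (ler_norm _) hc.
Qed.

Lemma cvg_mixture_infty (alpha : 'I_K -> R) (g : 'rV[R]_d -> R) :
  (forall k, k != i -> g (c k) @[c --> F] --> (0 : R)) ->
  \sum_(k < K) alpha k * g (c k) @[c --> F] --> alpha i * g thi.
Proof.
have FF := others_to_infty_proper i thi d0.
move=> g0.
rewrite (_ : alpha i * g thi =
  \sum_(k < K) (if k == i then alpha i * g thi else 0)); last first.
  by rewrite (bigD1 i)//= eqxx big1 ?addr0// => k /negbTE ->.
apply: cvg_sum_ord => k; case: eqP => [->|/eqP ki].
  (* The filter fixes [c i], so this term is constant along it. *)
  apply: cvg_near_cst; exists 0 => // c [_ ci _] /=.
  by rewrite ci.
by rewrite -[0](mulr0 (alpha k)); apply: cvgM; [exact: cvg_cst|exact: g0].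
Qed.

End outer_limit.

(** Probability space, sample and cluster sizes are indexed by the centroid family [c], as the law
    of the sample changes when centroids move. [L] collects the inner limits; the filter sees it
    only at injective [c] with [c i = thetai]. *)
Theorem proposition1 (R : realType) (d K : nat) (hd : (0 < d)%N)
    (disp : ('I_K -> 'rV[R]_d) -> measure_display)
    (Om : forall c : 'I_K -> 'rV[R]_d, measurableType (disp c))
    (P : forall c : 'I_K -> 'rV[R]_d, probability (Om c) R)
    (Y : forall c : 'I_K -> 'rV[R]_d, 'I_K -> nat -> {RV (P c) >-> 'rV[R]_d})
    (Ns : ('I_K -> 'rV[R]_d) -> nat -> 'I_K -> nat)
    (alpha : 'I_K -> R)
    (hYlaw : forall c : 'I_K -> 'rV[R]_d, injective c ->
       forall (k : 'I_K) (n : nat) (A : set 'rV[R]_d), measurable A ->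
       distribution (P c) (Y c k n) A = normal_row (c k) A)
    (hYindep : forall c : 'I_K -> 'rV[R]_d, injective c ->
       mutually_independent (fun kn : 'I_K * nat => Y c kn.1 kn.2))
    (hNs : forall c : 'I_K -> 'rV[R]_d, injective c ->
       forall N : nat, (\sum_(k < K) Ns c N k)%N = N)
    (halpha : forall k : 'I_K, 0 < alpha k < 1)
    (hNs_alpha : forall c : 'I_K -> 'rV[R]_d, injective c ->
       forall k : 'I_K, (Ns c N k)%:R / N%:R @[N --> \oo] --> alpha k)
    (i : 'I_K) (thetai : 'rV[R]_d) :
  \forall theta \near thetai,
    exists L : ('I_K -> 'rV[R]_d) -> 'rV[R]_d,
      (forall c : 'I_K -> 'rV[R]_d, injective c -> c i = thetai ->
         {ae P c, forall om : Om c,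
            weighted_mean (fun k n => Y c k n om) (Ns c N) theta - theta
              @[N --> \oo] --> L c}) /\
      (L c @[c --> others_to_infty i thetai] --> (0 : 'rV[R]_d) <->
         theta = thetai).
Proof.
apply: (@filterE _ (nbhs thetai)) => th.
have alpha0 k : 0 < alpha k by case/andP: (halpha k).
exists (fun c => \row_j ((\sum_(k < K) alpha k * weight_mean_coord th (c k) j) /
            (\sum_(k < K) alpha k * weight_mean th (c k)))).
split=> [c injc ci|].
  exact: (weighted_mean_cvg (hYlaw c injc) (hYindep c injc) alpha0
    (hNs_alpha c injc) th i hd).
have FF := others_to_infty_proper i thetai hd.
have lim_coord j : (\sum_(k < K) alpha k * weight_mean_coord th (c k) j) /
    (\sum_(k < K) alpha k * weight_mean th (c k)) @[c --> others_to_infty i thetai]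
    --> (alpha i * weight_mean_coord th thetai j) / (alpha i * weight_mean th thetai).
  apply: cvgM.
    apply: (@cvg_mixture_infty _ _ _ _ _ hd _
      (fun mu => weight_mean_coord th mu j)).
    by move=> k; exact: cvg_weight_mean_coord_infty.
  apply: cvgV; first by rewrite gt_eqF// mulr_gt0// weight_mean_gt0.
  apply: (@cvg_mixture_infty _ _ _ _ _ hd _ (weight_mean th)).
  by move=> k; exact: cvg_weight_mean_infty.
split=> [L0|thE].
  apply/rowP => j; apply/esym/eqP; rewrite -subr_eq0 -sgr_eq0.
  rewrite -(sgr_weight_mean_coord th thetai j hd) sgr_eq0.
  have := lim_coord j.
  have L0j : (\sum_(k < K) alpha k * weight_mean_coord th (c k) j) /
    (\sum_(k < K) alpha k * weight_mean th (c k)) @[c --> others_to_infty i thetai]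
    --> (0 : R).
    have := cvg_comp _ _ L0 (@coord_continuous R 1 d ord0 j 0).
    rewrite mxE; apply: cvg_trans; apply: near_eq_cvg.
    by apply: nearW => c /=; rewrite mxE.
  (* Both limits of the ratio agree; as alpha_i and H_i are positive, the coordinate of G_i is 0. *)
  move=> /(cvg_unique _ L0j) /esym/eqP.
  rewrite mulf_eq0 invr_eq0 !mulf_eq0 !(gt_eqF (alpha0 i))/=.
  move=> /(_ (@norm_hausdorff _ R)).
  by rewrite (gt_eqF (weight_mean_gt0 _ _ hd)) orbF.
rewrite thE in lim_coord *; apply: cvg_row => j; rewrite mxE.
have /eqP c0 : weight_mean_coord thetai thetai j == 0.
  by rewrite -sgr_eq0 sgr_weight_mean_coord// subrr sgr0.
have := lim_coord j; rewrite c0 mulr0 mul0r.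
by apply: cvg_trans; apply: near_eq_cvg; apply: nearW => c /=; rewrite mxE.
Qed.
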